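(* Let $d\ge 1$, let $\Sigma$ be a finite alphabet, and let $G:\Sigma^{\mathbb{Z}^d}\to\Sigma^{\mathbb{Z}^d}$ be a locally time-symmetric cellular automaton with respect to an involution $h$ of $\Sigma$; that is, $G$ is a reversible cellular automaton with $G^{-1}=H\circ G\circ H$, where $H$ applies $h$ to every cell. For $i\in\mathbb{Z}^d$ let $h_i$ be the map on $\Sigma^{\mathbb{Z}^d}$ that applies $h$ to cell $i$ and leaves all other cells unchanged, and let $L_i=G^{-1}\circ h_i\circ G$. Then $$G^2=H\circ\prod_{i\in\mathbb{Z}^d}L_i,$$ and furthermore $\mathrm{Loc}(L_0)\subseteq\mathcal{BN}$, where $\mathcal{BN}$ is the block neighborhood of $G$.
   Context: A reversible cellular automaton (RCA) over a finite alphabet $\Sigma$ on $\mathbb{Z}^d$ is a bijection $G$ of $\Sigma^{\mathbb{Z}^d}$ that commutes with all translations and is causal (there is a finite $\mathcal{N}\subset\mathbb{Z}^d$ such that $G(c)_0$ depends only on $c|_{\mathcal{N}}$), and whose inverse $G^{-1}$ has the same properties. A locally time-symmetric CA (LTSCA) is an RCA $G$ for which there exists an involution $h:\Sigma\to\Sigma$ ($h\circ h=\mathrm{id}$) such that $G^{-1}=H\circ G\circ H$, where $H=\prod_i h_i$ is the map $H(c)_i=h(c_i)$ for all $i\in\mathbb{Z}^d$. Localization: let $X$ be a set of cells and $f$ a bijection of $\Sigma^X$. For $Y\subseteq X$, $f$ is localized upon $Y$ if $f=f_Y\times\mathrm{id}_{X\setminus Y}$ for some bijection $f_Y$ of $\Sigma^Y$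 (identifying $\Sigma^X=\Sigma^Y\times\Sigma^{X\setminus Y}$). $\mathrm{Loc}(f)$ denotes the smallest (for inclusion) $Y\subseteq X$ upon which $f$ is localized. Semilocalizability: a bijection $F:A\times B\to C\times D$ is semilocalizable (with respect to these decompositions) if there are a set $E$ and bijections $g:A\to C\times E$ and $\tilde h:E\times B\to D$ such that $F=(\mathrm{id}_C\times\tilde h)\circ(g\times\mathrm{id}_B)$. Block neighborhood: $\mathcal{BN}$ is the smallest subset of $\mathbb{Z}^d$ such that $G$, viewed as a bijection $\Sigma^{\mathcal{BN}}\times\Sigma^{\mathbb{Z}^d\setminus\mathcal{BN}}\to\Sigma^{\{0\}}\times\Sigma^{\mathbb{Z}^d\setminus\{0\}}$, is semilocalizable. It is known that this smallest set exists and is finite. Infinite product: for a family of pairwise commuting bijections $(f_i)_i$ of $\Sigma^X$, each localized upon a finite set and such that every $x\in X$ lies in $\mathrm{Loc}(f_i)$ for only finitely many $i$, the product $\prod_i f_i$ is the map whose value at a configuration $w$ and cell $x$ is the common value of $\bigl(\prod_{i\in I}f_i\bigr)(w)_x$ for all sufficiently large finite index sets $I$. The maps $L_i$ form such a family. *)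

(* Defs.v *)
From mathcomp Require Import all_boot all_order all_algebra.
From mathcomp Require Import all_classical.

Set Implicit Arguments.
Unset Strict Implicit.
Unset Printing Implicit Defensive.

Import GRing.Theory.
Local Open Scope classical_set_scope.
Local Open Scope ring_scope.

Definition smallest_set (T : Type) (P : set T -> Prop) (Y : set T) : Prop :=
  P Y /\ forall Z, P Z -> Y `<=` Z.

Lemma smallest_set_unique (T : Type) (P : set T -> Prop) (Y Z : set T) :
  smallest_set P Y -> smallest_set P Z -> Y = Z.
Proof.
by move=> [PY leY] [PZ leZ]; apply/seteqP; split; [exact: leY|exact: leZ].
Qed.

(* [split_at Y] and [merge_at Y] are the two directions of the identification
   S^X = S^Y * S^(X \ Y); a set [Y] used as a type is the subtype of its
   elements. *)
Definition restriction (X S : Type) (Y : set X) (w : X -> S) : Y -> S :=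
  fun y => w (val y).

Definition split_at (X S : Type) (Y : set X) (w : X -> S) :
    (Y -> S) * (~` Y -> S) :=
  (restriction (Y := Y) w, restriction (Y := ~` Y) w).
Arguments split_at {X S} Y w.

Definition merge_at (X S : Type) (Y : set X) (p : (Y -> S) * (~` Y -> S)) :
    X -> S :=
  fun x => match pselect (Y x) with
           | left Yx => p.1 (exist _ x (mem_set Yx))
           | right nYx => p.2 (exist _ x (mem_set (A := ~` Y) nYx))
           end.
Arguments merge_at {X S} Y p.

Lemma split_atK (X S : Type) (Y : set X) :
  cancel (@split_at X S Y) (merge_at Y).
Proof. by move=> w; apply/funext => x; rewrite /merge_at; case: pselect. Qed.

Lemma merge_atK (X S : Type) (Y : set X) :
  cancel (@merge_at X S Y) (split_at Y).
Proof.
move=> [a b]; congr pair; apply/funext => -[x Yx];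
  rewrite /restriction /merge_at /=; case: pselect => h.
- by congr (a _); apply: val_inj.
- by case: h; exact: set_mem.
- by have /(_ h) := set_mem Yx.
- by congr (b _); apply: val_inj.
Qed.

Definition localized (X S : Type) (f : (X -> S) -> (X -> S)) (Y : set X) :
    Prop :=
  exists2 fY : (Y -> S) -> (Y -> S), bijective fY &
    forall w, split_at Y (f w) = (fY (split_at Y w).1, (split_at Y w).2).

Definition is_Loc (X S : Type) (f : (X -> S) -> (X -> S)) : set X -> Prop :=
  smallest_set (localized f).

Definition semilocalizable (A B C D : Type) (F : A * B -> C * D) : Prop :=
  exists (E : Type) (g : A -> C * E) (k : E * B -> D),
    [/\ bijective g, bijective k &
        forall a b, F (a, b) = ((g a).1, k ((g a).2, b))].

Definition product_family (I X : choiceType) (S : Type)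
    (f : I -> (X -> S) -> (X -> S)) : Prop :=
  [/\ forall i, bijective (f i),
      forall i j, f i \o f j = f j \o f i,
      forall i, exists2 Y, finite_set Y & localized (f i) Y &
      forall x, finite_set [set i | exists2 Y, is_Loc (f i) Y & Y x]].

(* A finite index set is given by a duplicate-free enumeration [s]; as the
   [f i] commute, the choice of the enumeration is immaterial. *)
Definition is_infinite_product (I X : choiceType) (S : Type)
    (f : I -> (X -> S) -> (X -> S)) (P : (X -> S) -> (X -> S)) : Prop :=
  product_family f /\
  forall w x, exists s0 : seq I, forall s : seq I,
    uniq s -> {subset s0 <= s} ->
    (\big[(fun u v => u \o v)/id]_(i <- s) f i) w x = P w x.

Lemma is_infinite_product_unique (I X : choiceType) (S : Type)
    (f : I -> (X -> S) -> (X -> S)) (P Q : (X -> S) -> (X -> S)) :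
  is_infinite_product f P -> is_infinite_product f Q -> P = Q.
Proof.
move=> [_ fP] [_ fQ]; apply/funext => w; apply/funext => x.
have [s sP] := fP w x; have [t tQ] := fQ w x.
rewrite -(sP (undup (s ++ t))) ?undup_uniq//; last first.
  by move=> i si; rewrite mem_undup mem_cat si.
by rewrite (tQ (undup (s ++ t))) ?undup_uniq// => i ti;
  rewrite mem_undup mem_cat ti orbT.
Qed.

Notation cell d := 'rV[int]_d.

Definition config (d : nat) (S : Type) : Type := cell d -> S.

Definition shift (d : nat) (S : Type) (t : cell d) (c : config d S) :
    config d S := fun x => c (x + t).

Definition translation_invariant (d : nat) (S : Type)
    (G : config d S -> config d S) : Prop :=
  forall t c, G (shift t c) = shift t (G c).

Definition causal (d : nat) (S : Type) (G : config d S -> config d S) : Prop :=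
  exists2 N : set (cell d), finite_set N &
    forall c c' : config d S, (forall x, N x -> c x = c' x) -> G c 0 = G c' 0.

Record rca (d : nat) (S : Type) := RCA {
  rca_fun :> config d S -> config d S;
  rca_inv : config d S -> config d S;
  rca_funK : cancel rca_fun rca_inv;
  rca_invK : cancel rca_inv rca_fun;
  rca_fun_translation : translation_invariant rca_fun;
  rca_inv_translation : translation_invariant rca_inv;
  rca_fun_causal : causal rca_fun;
  rca_inv_causal : causal rca_inv
}.

Definition apply_all (d : nat) (S : Type) (h : S -> S) (c : config d S) :
    config d S := fun x => h (c x).

Definition apply_at (d : nat) (S : Type) (h : S -> S) (i : cell d)
    (c : config d S) : config d S := fun x => if x == i then h (c x) else c x.

Definition locally_time_symmetric (d : nat) (S : Type) (G : rca d S)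
    (h : S -> S) : Prop :=
  involutive h /\ rca_inv G = apply_all h \o G \o apply_all h.

Definition conj_at (d : nat) (S : Type) (G : rca d S) (h : S -> S)
    (i : cell d) : config d S -> config d S :=
  rca_inv G \o apply_at h i \o G.

Definition is_block_neighborhood (d : nat) (S : Type) (G : rca d S) :
    set (cell d) -> Prop :=
  smallest_set (fun Y => semilocalizable
    (split_at [set (0 : cell d)] \o G \o merge_at Y)).

(* Main.v *)
(* Since [G^-1] is causal, the value of [prod_i L_i = G^-1 o (prod_i h_i) o G]
   at a cell involves only the [h_i] in a finite window, so the infinite product
   is [G^-1 o H o G = H o G o H o H o G = H o G^2].  If [G] splits along [BN] as
   [(id * k) o (g * id)], then [h_0] acts on the output of [g] alone, so [L_0]
   acts on [BN] alone, as [g^-1 o (h * id) o g].  An involution localized upon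
   two sets is localized upon their intersection, so [Loc L_0] exists and is
   included in [BN]. *)
Require Import Defs.
From mathcomp Require Import all_boot all_order all_algebra finmap.
From mathcomp Require Import all_classical.

Set Implicit Arguments.
Unset Strict Implicit.
Unset Printing Implicit Defensive.

Import GRing.Theory.
Local Open Scope classical_set_scope.
Local Open Scope ring_scope.

(** Descent on cardinality: if a finite [A] satisfying [P] fails to be included in some [Z]
    satisfying [P], the intersection of [A] and [Z] is a strictly smaller candidate. *)
Lemma smallest_set_exists (T : choiceType) (P : set T -> Prop) :
  (exists2 Y, finite_set Y & P Y) ->
  (forall Y Z, P Y -> P Z -> P (Y `&` Z)) ->
  exists Y, smallest_set P Y.
Proof.
move=> [Y0 /finite_fsetP[A0 ->] PA0] PI.
have [n] := ubnP #|` A0|; elim: n A0 PA0 => // n IHn A PA ltAn.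
have [minA|] := pselect (forall Z, P Z -> [set` A] `<=` Z).
  by exists [set` A]; split.
move=> /existsNP[Z] /not_implyP[PZ nAZ].
pose B := [fset x in A | `[< Z x >]]%fset.
have BE : [set` B] = [set` A] `&` Z.
  apply/seteqP; split=> x /=; rewrite !inE /=.
    by move=> /andP[? /asboolP].
  by move=> [xA Zx]; apply/andP; split=> //; apply/asboolP.
have ltBA : (#|` B| < #|` A|)%N.
  apply: fproper_ltn_card; rewrite fproperE; apply/andP; split.
    by apply/fsubsetP => x; rewrite !inE => /andP[].
  apply/negP => /fsubsetP AB; apply: nAZ => x /AB.
  by rewrite !inE => /andP[_ /asboolP].
by apply: (IHn B); [rewrite BE; exact: PI|exact: leq_trans ltBA _].
Qed.

Section Localization.
Variables (X S : Type).
Implicit Types (f : (X -> S) -> (X -> S)) (Y Z : set X) (w : X -> S).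

(** Trades the bijection of S^Y for two pointwise conditions. Since [f] is an involution, the map it
    induces on S^Y is its own inverse, so bijectivity comes for free. *)
Lemma localizedP f Y : involutive f ->
  localized f Y <->
  (forall w x, ~ Y x -> f w x = w x) /\
  (forall w w', {in Y, w =1 w'} -> {in Y, f w =1 f w'}).
Proof.
move=> fK; split=> [[fY _ fE]|[fN fY]].
  split=> [w x nYx|w w' ww' x Yx].
    have /(congr1 snd) /= := fE w.
    by move=> /(congr1 (fun u => u (exist _ x (mem_set (A := ~` Y) nYx)))).
  have eqY : restriction (Y := Y) w = restriction (Y := Y) w'.
    by apply/funext => -[y Yy]; exact: ww'.
  have : restriction (Y := Y) (f w) = restriction (Y := Y) (f w').
    have /(congr1 fst) /= -> := fE w; have /(congr1 fst) /= -> := fE w'.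
    by rewrite eqY.
  by move=> /(congr1 (fun u => u (exist _ x Yx))).
(* Extending a pattern on [Y] to all of [X] takes a default symbol [s]. If [S] is empty, a
   configuration exists only when [X] is empty, and [id] will do. *)
have [[s]|/forallNP noS] := pselect (exists s : S, True); last first.
  exists id; first by exists id.
  by move=> w; congr pair; apply/funext => -[x ?]; case: (noS (w x)).
move=> _.
pose ext (a : Y -> S) : X -> S := merge_at Y (a, fun=> s).
have extE a : restriction (Y := Y) (ext a) = a.
  by have /(congr1 fst) := merge_atK (a, fun=> s).
have ext_in w : {in Y, ext (restriction w) =1 w}.
  move=> x Yx.
  by have /(congr1 (fun u => u (exist _ x Yx))) := extE (restriction w).
pose F a := restriction (Y := Y) (f (ext a)).
have FE w : F (restriction w) = restriction (f w).
  by apply/funext => -[x Yx]; apply: fY => //; exact: ext_in.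
exists F; first by exists F => a; rewrite FE fK extE.
move=> w; rewrite /= FE; congr pair; apply/funext => -[x nYx].
by apply: fN; have := set_mem nYx.
Qed.

Lemma localizedI f Y Z : involutive f ->
  localized f Y -> localized f Z -> localized f (Y `&` Z).
Proof.
move=> fK /(localizedP _ fK)[fNY fY] /(localizedP _ fK)[fNZ fZ].
apply/(localizedP _ fK); split=> [w x /not_andP[]|w w' ww' x].
- exact: fNY.
- exact: fNZ.
rewrite in_setI => /andP[Yx Zx].
(* The hybrid [v] agrees with [w] on [Y] and with [w'] on [Z], so at [x], which lies in both, [f v]
   equals [f w] as well as [f w']. *)
pose v y := if y \in Y then w y else w' y.
have -> : f w x = f v x by apply: fY => // y Yy; rewrite /v Yy.
apply: fZ => // y Zy; rewrite /v; case: ifPn => // Yy.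
by apply: ww'; rewrite in_setI Yy.
Qed.

End Localization.

Lemma is_Loc_exists (X : choiceType) (S : Type) (f : (X -> S) -> (X -> S)) :
  involutive f -> (exists2 Y, finite_set Y & localized f Y) ->
  exists Y, is_Loc f Y.
Proof.
by move=> fK fY; apply: smallest_set_exists => // Y Z; exact: localizedI.
Qed.

Section CellularAutomata.
Variables (d : nat) (S : Type).
Implicit Types (F : config d S -> config d S) (G : rca d S) (h : S -> S).

Lemma causal_everywhere F : translation_invariant F -> causal F ->
  exists2 N : set (cell d), finite_set N & forall x (c c' : config d S),
    (forall y, N y -> c (x + y) = c' (x + y)) -> F c x = F c' x.
Proof.
move=> Ft [N finN FN]; exists N => // x c c' cc'.
have shiftE u : F u x = F (shift x u) 0 by rewrite Ft /shift add0r.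
by rewrite !shiftE; apply: FN => y /cc'; rewrite /shift addrC.
Qed.

Lemma apply_atK h i : involutive h -> involutive (@apply_at d S h i).
Proof.
by move=> hK c; apply/funext => x; rewrite /apply_at; case: (x == i).
Qed.

Lemma apply_atC h i j (c : config d S) :
  apply_at h i (apply_at h j c) = apply_at h j (apply_at h i c).
Proof. by apply/funext => x; rewrite /apply_at; do 2!case: ifP. Qed.

Lemma prod_apply_at h (s : seq (cell d)) (c : config d S) x : uniq s ->
  (\big[(fun u v => u \o v)/id]_(i <- s) apply_at h i) c x =
  if x \in s then h (c x) else c x.
Proof.
elim: s => [|i s IHs] /=; first by rewrite big_nil.
move=> /andP[is_ us]; rewrite big_cons /= /apply_at IHs // in_cons.
by case: eqVneq => //= ->; rewrite (negbTE is_).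
Qed.

Lemma conj_atK G h i : involutive h -> involutive (conj_at G h i).
Proof. by move=> hK c; rewrite /conj_at /= rca_invK apply_atK // rca_funK. Qed.

Lemma conj_atC G h i j :
  conj_at G h i \o conj_at G h j = conj_at G h j \o conj_at G h i.
Proof. by apply/funext => c; rewrite /conj_at /= !rca_invK apply_atC. Qed.

Lemma prod_conj_at G h (s : seq (cell d)) (c : config d S) :
  (\big[(fun u v => u \o v)/id]_(i <- s) conj_at G h i) c =
  rca_inv G ((\big[(fun u v => u \o v)/id]_(i <- s) apply_at h i) (G c)).
Proof.
elim: s => [|i s IHs]; first by rewrite !big_nil rca_funK.
by rewrite !big_cons /= IHs /conj_at /= rca_invK.
Qed.

Lemma conj_at_localized G h : involutive h ->
  exists2 D : set (cell d), finite_set D &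
    forall i, localized (conj_at G h i) [set i + t | t in D].
Proof.
move=> hK.
have [N finN GN] := causal_everywhere (@rca_fun_translation _ _ G)
  (@rca_fun_causal _ _ G).
have [M finM VM] := causal_everywhere (@rca_inv_translation _ _ G)
  (@rca_inv_causal _ _ G).
pose MN := [set m + n | m in M & n in N].
(* Changing cell [i] after [G] can alter only the cells [i - m]. The new value at such a cell
   depends on [G w] at [i - m + m'], hence on [w] at [i - m + m' + n]. The set does not depend on
   [i]. *)
exists ([set - m | m in M] `|` [set p - m | p in MN & m in M]).
  rewrite finite_setU; split; first exact: finite_image.
  by do 2?apply: finite_image2.
move=> i; apply/localizedP; first exact: conj_atK.
have fixed w x : (forall m, M m -> x + m != i) -> conj_at G h i w x = w x.
  move=> xM; rewrite -[in RHS](rca_funK G w); apply: VM => m /xM.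
  by rewrite /apply_at => /negbTE ->.
split=> [w x nD|w w' ww' x Dx].
  apply: fixed => m Mm; apply/eqP => xmi; apply: nD.
  by exists (- m); [left; exists m|rewrite -xmi addrK].
have [[m Mm xmi]|nM] := pselect (exists2 m, M m & x + m = i).
  apply: VM => m' Mm'; rewrite /apply_at.
  suff -> : G w (x + m') = G w' (x + m') by [].
  apply: GN => n Nn; apply: ww'; apply/mem_set; exists (m' + n - m).
    by right; exists (m' + n); [exists m' => //; exists n|exists m].
  by rewrite -xmi -addrA [m + _]addrC subrK addrA.
have xM m : M m -> x + m != i by move=> Mm; apply/eqP => xmi; apply: nM; exists m.
rewrite !fixed //; exact: ww'.
Qed.

Lemma conj_at_localized_block G h (Y : set (cell d)) : involutive h ->
  semilocalizable (split_at [set (0 : cell d)] \o G \o merge_at Y) ->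
  localized (conj_at G h 0) Y.
Proof.
move=> hK [E [g [k [[g' gK g'K] _ GE]]]].
pose F a := g' (h \o (g a).1, (g a).2).
have FK : involutive F.
  move=> a; rewrite /F g'K /= -[RHS]gK; congr (g' _).
  by case: (g a) => u e; congr pair; apply/funext => x /=.
exists F; first by exists F.
move=> w; rewrite -(split_atK Y w); case: (split_at Y w) => a b.
suff -> : conj_at G h 0 (merge_at Y (a, b)) = merge_at Y (F a, b).
  by rewrite !merge_atK.
(* Compare the images under [G]: replacing [a] by [F a] applies [h] to the first output of [g] and
   keeps the [E] part, so only cell 0 changes. *)
rewrite /conj_at -[RHS](rca_funK G) /=; congr (rca_inv G _).
apply: (can_inj (split_atK [set 0])).
have /= -> := GE (F a) b; rewrite /F g'K /=.
have := GE a b; rewrite /= => -[<- <-].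
by congr pair; apply/funext => -[x x0]; rewrite /restriction /apply_at /=;
  have := set_mem x0; case: eqP.
Qed.

Lemma conj_at_product_family G h : involutive h ->
  product_family (conj_at G h).
Proof.
move=> hK; have [D finD LD] := conj_at_localized G hK.
split=> [i|i j|i|x].
- by exists (conj_at G h i); exact: conj_atK.
- exact: conj_atC.
- by exists [set i + t | t in D] => //; exact: finite_image.
(* By minimality the Loc of the [i]-th map lies in [i + D], so it contains [x] only if [i] is in
   [x - D]. *)
apply: (@sub_finite_set _ _ [set x - t | t in D]); last exact: finite_image.
move=> i [Y [_ /(_ _ (LD i)) YD] /YD[t Dt <-]].
by exists t => //; rewrite addrK.
Qed.

Lemma conj_at_infinite_product G h : involutive h ->
  is_infinite_product (conj_at G h) (rca_inv G \o apply_all h \o G).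
Proof.
move=> hK; split; first exact: conj_at_product_family.
move=> w x.
have [M /finite_fsetP[A AE] VM] := causal_everywhere
  (@rca_inv_translation _ _ G) (@rca_inv_causal _ _ G).
(* These are the cells that [rca_inv G] reads to compute cell [x]; once [s] contains them, the
   partial product and [apply_all h] agree there. *)
exists [seq x + m | m <- A] => s us As; rewrite prod_conj_at.
apply: VM => m Mm; rewrite prod_apply_at // As //.
by apply: map_f; move: Mm; rewrite AE.
Qed.

End CellularAutomata.

Theorem corollary2 (d : nat) (Sigma : finType) (G : rca d Sigma)
    (h : Sigma -> Sigma) :
  (0 < d)%N ->
  locally_time_symmetric G h ->
  (exists2 P : config d Sigma -> config d Sigma,
     is_infinite_product (conj_at G h) P &
     (G \o G = apply_all h \o P)%FUN) /\
  (exists2 Y : set (cell d), is_Loc (conj_at G h 0%R) Y &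
     forall BN : set (cell d), is_block_neighborhood G BN ->
       (Y `<=` BN)%classic).
Proof.
move=> _ [hK GV]; split.
  exists (rca_inv G \o apply_all h \o G).
    exact: conj_at_infinite_product.
  have HK : involutive (@apply_all d Sigma h).
    by move=> c; apply/funext => x; exact: hK.
  by apply/funext => c; rewrite GV /= !HK.
have [_ _ /(_ 0) fin0 _] := conj_at_product_family G hK.
have [Y LocY] := is_Loc_exists (conj_atK G 0 hK) fin0.
(* Minimality of [Y] reduces the inclusion to localization upon [BN]. *)
exists Y => // BN [semiBN _]; case: LocY => _; apply.
exact: conj_at_localized_block.
Qed.
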